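(* (a) If $G\cong D_{2m}$ or $G\cong U_{(n,m)}$ (with $n\ge2$), where $m\ge4$ and both $m$ and $m/2$ are even, then $\Gamma_G$ is Q-integral iff $m=4$. (b) If $G\cong T_{4m}$ with $m\ge2$ even, then $\Gamma_G$ is Q-integral iff $m=2$. (c) If $G\cong V_{8m}$ with $m\ge2$, then $\Gamma_G$ is Q-integral iff $m=2$. (d) If $G\cong SD_{8m}$ with $m\ge2$ even, then $\Gamma_G$ is not Q-integral.
   Context: Groups: $D_{2m}=\langle x,y\mid x^m=y^2=1,\ yxy^{-1}=x^{-1}\rangle$; $T_{4m}=\langle x,y\mid x^{2m}=1,\ x^m=y^2,\ y^{-1}xy=x^{-1}\rangle$; $SD_{8m}=\langle x,y\mid x^{4m}=y^2=1,\ yxy=x^{2m-1}\rangle$; $U_{(n,m)}=\langle x,y\mid x^{2n}=y^m=1,\ x^{-1}yx=y^{-1}\rangle$; $V_{8m}=\langle x,y\mid x^{2m}=y^4=1,\ yx=x^{-1}y^{-1},\ y^{-1}x=x^{-1}y\rangle$. The NCCC-graph $\Gamma_G$ of a finite non-abelian group $G$ has vertex set $\{x^G: x\in G\setminus Z(G)\}$ ($x^G$ the conjugacy class of $x$), distinct vertices $x^G,y^G$ adjacent iff $x'y'\neq y'x'$ for all $x'\in x^G,y'\in y^G$. A graph is Q-integral if all eigenvalues of its signless Laplacian $Q=D+A$ ($A$ adjacency, $D$ degree matrix) are integers. *)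

(* Defs.v *)
From mathcomp Require Import all_boot all_order all_algebra all_fingroup all_solvable all_field.
Set Implicit Arguments. Unset Strict Implicit. Unset Printing Implicit Defensive.
Import GRing.Theory Num.Theory.

Local Open Scope group_scope.
Section NCCC.
Variable gT : finGroupType.
Implicit Type G : {group gT}.

Definition nccc_vertices G : {set {set gT}} :=
  [set C in classes G | ~~ (C \subset 'Z(G))].

Definition nccc_adj G (C D : {set gT}) : bool :=
  (C != D) && [forall x in C, forall y in D, (x * y != y * x)%g].

Definition nccc_deg G (C : {set gT}) : nat :=
  #|[set D in nccc_vertices G | nccc_adj G C D]|.

Local Open Scope ring_scope.

Definition nccc_adjmx G : 'M[algC]_#|nccc_vertices G| :=
  \matrix_(i, j) (nccc_adj G (enum_val i) (enum_val j))%:R.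

Definition nccc_degmx G : 'M[algC]_#|nccc_vertices G| :=
  \matrix_(i, j) ((i == j)%:R * (nccc_deg G (enum_val i))%:R).

Definition nccc_signless_laplacian G := nccc_degmx G + nccc_adjmx G.

Definition nccc_Q_integral G : Prop :=
  forall a : algC, eigenvalue (nccc_signless_laplacian G) a -> a \is a Num.int.
End NCCC.

(* Main.v *)
Require Import Defs.
From mathcomp Require Import all_boot all_order all_algebra all_fingroup all_solvable all_field.
From mathcomp Require Import zify ring.

(** All five families are covered by one statement: if a finite group [G] has
an abelian subgroup [A] of index 2 and its derived subgroup is cyclic of even
order [n], then [G] is Q-integral if and only if [n = 2].  An element [u]
outside [A] inverts [G'], so [G'] meets ['Z(G)] in the 2-torsion of a cyclic
group of even order, which has order 2; hence [M = G' 'Z(G)] has index 2 in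
[A].  The classes in [A], in [M u] and in [(A \ M) u] are then the parts of a
complete tripartite graph, of sizes [p (n - 1)], [p] and [p] with
[p = #|'Z(G)| / 2].  For part sizes [p k, p, p], the signless Laplacian has the
eigenvalues [p mu] with [mu ^ 2 - (k + 4) mu + 4 = 0], whose discriminant
[k ^ 2 + 8 k] is a square only for [k = 1]; for [k = 1] the eigenvalues are
[p], [2 p] and [4 p].

Each presentation has generators [a], [t] with [A = <a, t ^ 2>] and
[G' = <[a, t]>]; the order of [[a, t]] is bounded below by permutation
models of metacyclic quotients. *)

Set Implicit Arguments. Unset Strict Implicit. Unset Printing Implicit Defensive.
Import Order.TTheory GRing.Theory Num.Theory.

(** * Spectrum of the signless Laplacian of a complete tripartite graph *)

Section Multipartite.
Local Open Scope ring_scope.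
Variables (N : nat) (I : finType) (c : 'I_N -> I).

Definition colour_class_size (q : I) : nat := #|[pred i | c i == q]|.

Definition multipartite_Q : 'M[algC]_N :=
  \matrix_(i, j) ((i == j)%:R * #|[pred l | c i != c l]|%:R + (c i != c j)%:R).

Lemma sum_colour (F : I -> algC) :
  \sum_i F (c i) = \sum_q (colour_class_size q)%:R * F q.
Proof.
rewrite (partition_big c predT) //=; apply: eq_bigr => q _.
rewrite (eq_bigr (fun=> F q)) => [|i /eqP-> //].
by rewrite sumr_const mulr_natl.
Qed.

Lemma mul_multipartite_Q (v : 'rV_N) (j : 'I_N) :
  (v *m multipartite_Q) 0 j =
    #|[pred l | c j != c l]|%:R * v 0 j + (\sum_i v 0 i - \sum_(i | c i == c j) v 0 i).
Proof.
rewrite mxE (eq_bigr (fun i => (i == j)%:R * (#|[pred l | c i != c l]|%:R * v 0 i)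
   + (c i != c j)%:R * v 0 i)); last by move=> i _; rewrite mxE; ring.
rewrite big_split /=; congr (_ + _).
  rewrite (bigD1 j) //= eqxx mul1r big1 ?addr0 // => i /negPf->.
  by rewrite mul0r.
rewrite (bigID (fun i => c i == c j)) /= [X in _ = X - _](bigID (fun i => c i == c j)) /=.
rewrite big1 ?add0r => [|i ->]; last by rewrite mul0r.
rewrite addrAC subrr add0r; apply: eq_bigr => i ->; exact: mul1r.
Qed.

Hypothesis cardI : #|I| = 3%N.
Variables (q0 : I) (p k : nat).
Hypotheses (p_gt0 : (0 < p)%N) (k_gt0 : (0 < k)%N).
Hypothesis size_q0 : colour_class_size q0 = (p * k)%N.
Hypothesis size_neq_q0 : forall q, q != q0 -> colour_class_size q = p.

Lemma sum_colour_q0 (F : I -> algC) (a b : algC) :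
    F q0 = a -> (forall q, q != q0 -> F q = b) ->
  \sum_i F (c i) = p%:R * (k%:R * a + 2%:R * b).
Proof.
move=> Fa Fb; rewrite sum_colour (bigD1 q0) //= Fa size_q0.
rewrite (eq_bigr (fun=> p%:R * b)) => [|q qq0]; last by rewrite Fb ?size_neq_q0.
rewrite sumr_const (_ : #|_| = 2); first by ring.
by move: (cardC1 q0); rewrite cardI.
Qed.

Lemma degree_colour j :
  #|[pred l | c j != c l]| = if c j == q0 then (2 * p)%N else (p * k.+1)%N.
Proof.
(* The count is made in [algC], where the colour sums above apply; injectivity of the cast brings it
   back to [nat]. *)
have: #|[pred l | c j != c l]|%:R = (if c j == q0 then (2 * p)%N else (p * k.+1)%N)%:R :> algC.
  rewrite -sum1_card natr_sum big_mkcond /=.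
  pose F q : algC := (c j != q)%:R.
  rewrite (eq_bigr (fun i => F (c i))); last by move=> i _; rewrite inE /F; case: eqP.
  case: eqP => [cj|/eqP cj].
    rewrite (@sum_colour_q0 _ 0 1) /F ?cj ?eqxx //; first by rewrite natrM; ring.
    by move=> q; rewrite eq_sym => ->.
  rewrite sum_colour (bigD1 q0) //= (bigD1 (c j)) //= /F cj eqxx size_q0.
  rewrite (eq_bigr (fun=> p%:R)) => [|q /andP[q1 q2]]; last first.
    by rewrite size_neq_q0 // eq_sym q2 mulr1.
  rewrite sumr_const (_ : #|_| = 1%N); first by rewrite /= -[k.+1]addn1 !natrM natrD; ring.
  have := cardsC [set q0; c j]; rewrite cards2 eq_sym cj cardI => card2.
  apply: (@addnI 2); rewrite -[RHS]card2; congr (_ + _)%N.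
  by apply: eq_card => q; rewrite !inE negb_or.
by move/eqP; rewrite eqr_nat => /eqP.
Qed.

Lemma colour_inhabited q : exists i, c i = q.
Proof.
have: (0 < colour_class_size q)%N.
  by have [->|/size_neq_q0->//] := eqVneq q q0; rewrite size_q0 muln_gt0 p_gt0.
by case/card_gt0P=> i; rewrite inE => /eqP; exists i.
Qed.

(** The eigenvector is 2 on the part [q0] and [mu - 2] on the other two. At [q0] the eigenvalue
    equation is then an identity; elsewhere it becomes the quadratic equation in [mu]. *)
Lemma eigenvalue_quotient (mu : algC) :
  mu ^+ 2 - (k + 4)%:R * mu + 4%:R = 0 -> eigenvalue multipartite_Q (p%:R * mu).
Proof.
move=> mu0; apply/eigenvalueP.
pose F q : algC := if q == q0 then 2%:R else mu - 2%:R.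
exists (\row_j F (c j)); last first.
  have [i ci] := colour_inhabited q0.
  apply/eqP=> /rowP/(_ i); rewrite !mxE /F ci eqxx => /eqP.
  by rewrite pnatr_eq0.
apply/rowP=> j; rewrite mul_multipartite_Q !mxE.
rewrite (eq_bigr (fun i => F (c i))); last by move=> i _; rewrite mxE.
rewrite (@sum_colour_q0 _ 2%:R (mu - 2%:R)) /F ?eqxx //; last by move=> q /negPf->.
rewrite (eq_bigr (fun i => F (c j))); last by move=> i /eqP ci; rewrite mxE -ci.
rewrite sumr_const degree_colour /F -/(colour_class_size (c j)).
have [->|cj] := eqVneq (c j) q0.
  by rewrite size_q0 -mulr_natl !natrM; ring.
rewrite size_neq_q0 // -[k.+1]addn1 !natrM natrD.
have mu2 : mu * (mu - 2%:R) = k%:R * 2%:R + (k%:R + 2%:R) * (mu - 2%:R).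
  apply/eqP; rewrite -subr_eq0; apply/eqP; rewrite -[RHS]mu0 natrD; ring.
rewrite -[RHS]mulrA mu2; ring.
Qed.

(** With [s] a square root of the discriminant [(k + 4) ^ 2 - 16], integrality of the eigenvalue
    [p * mu] makes [p ^ 2 * (k ^ 2 + 8 * k)] a perfect square. *)
Lemma multipartite_Q_integral_k_eq1 :
  (forall a, eigenvalue multipartite_Q a -> a \is a Num.int) -> k = 1%N.
Proof.
pose s := sqrtC ((k ^ 2 + 8 * k)%:R : algC).
have s2 : s ^+ 2 = (k ^ 2 + 8 * k)%:R by rewrite sqrtCK.
pose mu := ((k + 4)%:R + s) / 2%:R.
have two_mu : 2%:R * mu = (k + 4)%:R + s by rewrite mulrC divfK // pnatr_eq0.
have mu0 : mu ^+ 2 - (k + 4)%:R * mu + 4%:R = 0.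
  apply: (@mulfI _ 4%:R); first by rewrite pnatr_eq0.
  have -> : 4%:R * (mu ^+ 2 - (k + 4)%:R * mu + 4%:R) =
     (2%:R * mu) ^+ 2 - 2%:R * (k + 4)%:R * (2%:R * mu) + 16%:R by ring.
  by rewrite two_mu mulr0; move: s2; rewrite 2!natrD natrX natrM => s2; ring: s2.
move=> /(_ _ (eigenvalue_quotient mu0)) /intrP[l Dl].
have: ((2 * l - (p * (k + 4))%N%:Z) ^+ 2)%:~R = ((p ^ 2 * (k ^ 2 + 8 * k))%N%:Z)%:~R :> algC.
  rewrite rmorphXn rmorphB rmorphM /= -Dl -!pmulrn !natrM -s2.
  have -> : 2%:~R * (p%:R * mu) = p%:R * (2%:R * mu) :> algC by ring.
  by rewrite two_mu; ring.
move/intr_inj; set d := (_ - _)%R => /(congr1 absz); rewrite abszX /= => d2.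
have /dvdnP[t Dt]: (p %| `|d|)%N by rewrite -(@dvdn_pexp2r _ _ 2) // d2 dvdn_mulr.
have {d2 Dt d Dl l} : (t ^ 2 = k ^ 2 + 8 * k)%N.
  apply/eqP; rewrite -(@eqn_pmul2l (p ^ 2)) ?expn_gt0 ?p_gt0 // -d2 Dt.
  by rewrite expnMn mulnC.
(* The square root [t] lies strictly between [k] and [k + 4]; [t = k + 1] and [t = k + 3] fail by
   parity, and [t = k + 2] gives [k = 1]. *)
rewrite !expnS !expn0 => tk; have [kt tk4] : (k < t /\ t < k + 4)%N by move: tk k_gt0; clear; nia.
have [e De]: exists e, t = (k + e)%N by exists (t - k)%N; rewrite subnKC // ltnW.
rewrite {}De in tk kt tk4; case: e => [|[|[|[|e]]]] in tk kt tk4 *; lia.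
Qed.

(** All parts have size [p]. Summing the eigenvector equation over one part, then over all three,
    shows that for [a] other than [p], [2 * p], [4 * p] the total [S], the part sums and finally the
    entries of [v] vanish. *)
Lemma multipartite_Q_integral1 a :
  k = 1%N -> eigenvalue multipartite_Q a -> a \is a Num.int.
Proof.
move=> k1 /eigenvalueP[v va v0].
have size_q q : colour_class_size q = p.
  by have [->|/size_neq_q0//] := eqVneq q q0; rewrite size_q0 k1 muln1.
pose S := \sum_i v 0 i; pose Sc q := \sum_(i | c i == q) v 0 i.
have vE j : (a - (2 * p)%:R) * v 0 j = S - Sc (c j).
  move/rowP/(_ j): va; rewrite mul_multipartite_Q degree_colour mxE k1.
  rewrite [(p * 2)%N]mulnC if_same -/S -/(Sc _) mulrBl => <-; ring.
have ScE q : (a - p%:R) * Sc q = p%:R * S.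
  have: (a - (2 * p)%:R) * Sc q = p%:R * (S - Sc q).
    rewrite mulr_sumr (eq_bigr (fun=> S - Sc q)) => [|i /eqP <-]; last exact: vE.
    by rewrite sumr_const -/(colour_class_size q) size_q mulr_natl.
  rewrite natrM => /eqP; rewrite -subr_eq0 => /eqP e.
  by apply/eqP; rewrite -subr_eq0; apply/eqP; rewrite -[RHS]e; ring.
have SE : (a - p%:R) * S = 3%:R * p%:R * S.
  rewrite {1}/S (partition_big c predT) //= mulr_sumr.
  rewrite (eq_bigr (fun=> p%:R * S)) => [|q _]; last exact: ScE.
  by rewrite sumr_const cardI -mulrA [in RHS]mulr_natl.
have [->|a_p] := eqVneq a p%:R; first by rewrite intr_nat ?natr_nat.
have [->|a_2p] := eqVneq a (2 * p)%:R; first by rewrite intr_nat ?natr_nat.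
have [S0|S_neq0] := eqVneq S 0; last first.
  have /(mulIf S_neq0)/eqP := SE; rewrite subr_eq => /eqP->.
  by rewrite -natrM -natrD intr_nat ?natr_nat.
case/eqP: v0; apply/rowP=> j; rewrite mxE; apply: (@mulfI _ (a - (2 * p)%:R)).
  by rewrite subr_eq0.
rewrite vE S0 sub0r mulr0; apply/eqP; rewrite oppr_eq0.
by have /eqP := ScE (c j); rewrite S0 mulr0 mulf_eq0 subr_eq0 (negPf a_p).
Qed.
End Multipartite.

(** * Auxiliary facts on groups and counting *)

Local Open Scope group_scope.

(** The images of the generators commute modulo [H], so the quotient of [<<S>>] is abelian. *)
Lemma der1_gen_sub (gT : finGroupType) (S : {set gT}) (H : {group gT}) :
    S \subset 'N(H) -> {in S &, forall x y, [~ x, y] \in H} ->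
  <<S>>^`(1) \subset H.
Proof.
move=> nHS commS; apply: der1_min; first by rewrite gen_subG.
rewrite quotient_gen // abelian_gen /abelian quotient_cents2 // gen_subG.
by apply/subsetP=> _ /imset2P[x y Sx Sy ->]; apply: commS.
Qed.

Lemma index2_setD (gT : finGroupType) (A M : {group gT}) (a : gT) :
  M \subset A -> #|A : M| = 2 -> a \in A :\: M -> A :\: M = M :* a.
Proof.
move=> sMA iMA; rewrite inE => /andP[Ma Aa].
have cardA : #|A| = (2 * #|M|)%N by rewrite -(Lagrange sMA) iMA mulnC.
apply/esym/eqP; rewrite eqEcard card_rcoset cardsD (setIidPr sMA) cardA.
rewrite mul2n -addnn addnK leqnn andbT; apply/subsetP=> _ /rcosetP[b Mb ->].
by rewrite inE groupMl // Ma groupM // (subsetP sMA).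
Qed.

(** Turns counts over matrix indices, such as the degrees and part sizes of [multipartite_Q], into
    counts over conjugacy classes. *)
Lemma card_enum_val (T : finType) (A : {set T}) (P : pred T) :
  #|[pred i : 'I_#|A| | P (enum_val i)]| = #|[set x in A | P x]|.
Proof.
transitivity (\sum_(i < #|A| | P (enum_val i)) 1)%N; first by rewrite sum1_card.
rewrite -(@big_enum_val_cond _ _ _ _ (mem A) P (fun=> 1%N)) sum1_card.
by apply: eq_card => x; rewrite !inE.
Qed.

(** * Groups with an abelian subgroup of index 2 and cyclic derived subgroup of even order *)

Section AbelianIndex2.
Variables (gT : finGroupType) (G A : {group gT}).
Hypotheses (sAG : A \subset G) (abelA : abelian A) (iAG : #|G : A| = 2).
Hypotheses (cycG' : cyclic G^`(1)) (evenG' : ~~ odd #|G^`(1)|).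

Let nsAG : A <| G. Proof. exact: index2_normal. Qed.

Let commA a b : a \in A -> b \in A -> a * b = b * a.
Proof. by move=> Aa Ab; apply: (centsP abelA). Qed.

Let setDA u : u \in G :\: A -> G :\: A = A :* u.
Proof. exact: index2_setD. Qed.

Let memG u x : u \in G :\: A -> x \in G -> x \notin A -> exists2 a, a \in A & x = a * u.
Proof.
move=> GAu Gx Ax; have : x \in G :\: A by rewrite inE Ax.
by rewrite (setDA GAu) => /rcosetP[a Aa ->]; exists a.
Qed.

Let nonabelG : ~~ abelian G.
Proof.
by apply: contra evenG' => abG; rewrite (derG1P abG) cards1.
Qed.

Let central_of_comm u a :
  u \in G :\: A -> a \in A -> a * u = u * a -> a \in 'Z(G).
Proof.
move=> GAu Aa au; apply/centerP; split=> [|x Gx]; first exact: (subsetP sAG).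
have [Ax|nAx] := boolP (x \in A); first exact: commA.
have [b Ab ->] := memG GAu Gx nAx.
by rewrite /commute mulgA (commA Aa Ab) -!mulgA au.
Qed.

(** A central [z] outside [A] would make all of [A] central, and [G], the union of [A] and [A z],
    abelian. *)
Let sZA : 'Z(G) \subset A.
Proof.
apply/subsetP=> z Zz; apply: contraR nonabelG => Az.
have /centerP[Gz cz] := Zz.
have GAz : z \in G :\: A by rewrite inE Az.
have sAZ : A \subset 'Z(G).
  by apply/subsetP=> a Aa; apply: (central_of_comm GAz) => //; rewrite cz ?(subsetP sAG).
apply/centsP=> x Gx y Gy.
have [Ax|Ax] := boolP (x \in A).
  by have /(subsetP sAZ)/centerP[_ cx] := Ax; apply: cx.
have [a Aa ->] := memG GAz Gx Ax.
have /centerP[_ cxy] : a * z \in 'Z(G) by rewrite groupM // (subsetP sAZ).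
exact: cxy.
Qed.

Let sG'A : G^`(1) \subset A.
Proof.
apply: der1_min (normal_norm nsAG) _; apply: cyclic_abelian.
by apply: prime_cyclic; rewrite card_quotient ?normal_norm // iAG.
Qed.

Let sqr_mem_A u : u \in G :\: A -> u ^+ 2 \in A.
Proof.
move=> GAu; have := GAu; rewrite inE => /andP[Au Gu].
apply: contraR Au => Auu; have [a Aa] := memG GAu (groupX 2 Gu) Auu.
by rewrite expgS expg1 => /mulIg->.
Qed.

Let memJA a u : a \in A -> u \in G -> a ^ u \in A.
Proof. by move=> Aa Gu; rewrite memJ_norm // (subsetP (normal_norm nsAG)). Qed.

(** As [A] is abelian and normal, [a |-> [~ u, a]] is multiplicative on [A], so its image is a
    subgroup. It is normalised by [u] and [A], which generate [G], and contains their
    commutators. *)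
Let commg_image u : u \in G :\: A -> G^`(1) = [set [~ u, a] | a in A].
Proof.
move=> GAu; have := GAu; rewrite inE => /andP[Au Gu].
have commuA a : a \in A -> [~ u, a] \in A.
  by move=> Aa; rewrite commgEr groupM // memJA // groupV.
have gB : group_set [set [~ u, a] | a in A].
  apply/group_setP; split=> [|_ _ /imsetP[a Aa ->] /imsetP[b Ab ->]].
    by apply/imsetP; exists 1; rewrite ?group1 // commg1.
  apply/imsetP; exists (a * b); first exact: groupM.
  have [Aau Abu] : a^-1 ^ u \in A /\ b^-1 ^ u \in A by rewrite !memJA ?groupV.
  rewrite !commgEr invMg conjMg; move: (a^-1 ^ u) (b^-1 ^ u) Aau Abu => p q Ap Aq.
  by rewrite [q * p]commA // -!mulgA; congr (_ * _); rewrite mulgA [a * q]commA // -mulgA.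
apply/eqP; rewrite eqEsubset; apply/andP; split; last first.
  by apply/subsetP=> _ /imsetP[a Aa ->]; rewrite mem_commg // (subsetP sAG).
have genG : <<u |: A>> = G.
  apply/eqP; rewrite eqEsubset gen_subG subUset sub1set Gu sAG /=.
  apply/subsetP=> x Gx; have [Ax|Ax] := boolP (x \in A).
    by rewrite mem_gen // inE Ax orbT.
  have [a Aa ->] := memG GAu Gx Ax.
  by rewrite groupM // mem_gen // inE ?Aa ?orbT // inE eqxx.
rewrite -{1}genG; apply: (@der1_gen_sub _ _ (Group gB)) => /=.
  apply/subsetP=> x /setU1P[->|Ax]; rewrite inE; apply/subsetP=> _ /imsetP[_ /imsetP[a Aa ->] ->].
    apply/imsetP; exists (a ^ u); first exact: memJA.
    by rewrite conjRg conjgE mulKg.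
  apply/imsetP; exists a => //; apply/conjg_fixP/commgP.
  by apply: commA; rewrite ?commuA.
move=> x y /setU1P[->|Ax] /setU1P[->|Ay].
- by rewrite commgg (group1 (Group gB)).
- by apply/imsetP; exists y.
- by rewrite -invgR (groupV (Group gB)); apply/imsetP; exists x.
by have /commgP/eqP-> : commute x y; [apply: commA | exact: (group1 (Group gB))].
Qed.

(** Write [b = [~ u, a] = a^-1 ^ u * a]. Since [u ^+ 2] lies in [A] and so commutes with [a],
    conjugation by [u] exchanges [a] and [a ^ u]. *)
Let conj_der1 u b : u \in G :\: A -> b \in G^`(1) -> b ^ u = b^-1.
Proof.
move=> GAu; have := GAu; rewrite inE => /andP[Au Gu].
rewrite (commg_image GAu) => /imsetP[a Aa ->].
rewrite commgEr conjMg -conjgM -(expgS u 1) invMg -conjVg invgK.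
rewrite [a^-1 ^ _]conjgE (commA _ (sqr_mem_A GAu)) ?groupV //.
by rewrite mulKg.
Qed.

Let setDA_inhabited : exists u, u \in G :\: A.
Proof.
apply/set0Pn; apply/eqP=> /eqP; rewrite setD_eq0 => sGA.
by have := indexg_eq1 G A; rewrite iAG sGA.
Qed.

(** An element of [G'] is central iff it commutes with [u], that is, iff it equals its inverse; a
    cyclic group of even order has exactly two such elements. *)
Let card_der1_center : #|G^`(1) :&: 'Z(G)| = 2.
Proof.
have [u GAu] := setDA_inhabited.
have /cyclicP[w defG'] := cycG'.
have G'w : w \in G^`(1) by rewrite defG' cycle_id.
have ow : #[w] = (2 * (#[w])./2)%N.
  by rewrite mul2n -[LHS]odd_double_half {1}orderE -defG' (negPf evenG').
have q_gt0 : (0 < #[w]./2)%N by have := order_gt0 w; rewrite {1}ow; case: (_./2).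
have -> : G^`(1) :&: 'Z(G) = <[w ^+ #[w]./2]>.
  apply/eqP; rewrite eqEsubset cycle_subG inE groupX // andbC.
  apply/andP; split.
    apply: (central_of_comm GAu); first by rewrite groupX // (subsetP sG'A).
    apply/commgP/conjg_fixP; rewrite conj_der1 ?groupX //.
    apply/eqP; rewrite eq_invg_mul -expgD addnn -mul2n -ow expg_order; exact: eqxx.
  apply/subsetP=> b /setIP[]; rewrite {1}defG' => /cycleP[i ->] /centerP[_ cwi].
  have : (w ^+ i) ^ u = w ^+ i.
    apply/conjg_fixP/commgP; apply: cwi; by move: GAu; rewrite inE => /andP[].
  rewrite (conj_der1 GAu (groupX i G'w)) => /eqP; rewrite eq_invg_mul -expgD -order_dvdn addnn -mul2n.
  rewrite {1}ow dvdn_pmul2l // => /dvdnP[j ->].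
  by rewrite [(j * _)%N]mulnC expgM; apply: mem_cycle.
rewrite -orderE orderXdiv; first by rewrite [X in X %/ _]ow mulnK.
by rewrite [X in _ %| X]ow dvdn_mull.
Qed.

(** Because [u ^ a = u * [~ u, a]] and the commutators [[~ u, a]] with [a] in [A] already exhaust
    [G']. *)
Let class_setDA u : u \in G :\: A -> u ^: G = G^`(1) :* u.
Proof.
move=> GAu; have := GAu; rewrite inE => /andP[Au Gu].
have nG'G x : x \in G -> x \in 'N(G^`(1)) by apply/subsetP/normal_norm/der_normal.
rewrite norm_rlcoset ?nG'G //; apply/setP=> x; rewrite mem_lcoset.
apply/imsetP/idP=> [[g Gg ->]|]; first by rewrite conjg_mulR mulKg mem_commg.
move=> G'ux; have : u^-1 * x \in [set [~ u, a] | a in A] by rewrite -(commg_image GAu).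
case/imsetP=> a Aa ua; by exists a; rewrite ?(subsetP sAG) // conjg_mulR -ua mulKVg.
Qed.

(** The centre is the centraliser of [u] in [A], and its index is the length of the [A]-orbit of
    [u], a translate of [G']. *)
Let card_der1_mul_center : (#|G^`(1)| * #|'Z(G)|)%N = #|A|.
Proof.
have [u GAu] := setDA_inhabited.
have := GAu; rewrite inE => /andP[Au Gu].
have -> : 'Z(G) = 'C_A[u].
  apply/setP=> z; apply/idP/setIP => [Zz|[Az /cent1P cz]]; last first.
    exact: (central_of_comm GAu).
  have /centerP[_ cz] := Zz.
  by split; [apply: (subsetP sZA) | apply/cent1P; apply: cz].
rewrite -(Lagrange (subsetIl A 'C[u])) mulnC index_cent1 (commg_image GAu).
congr (_ * _)%N; rewrite -(card_imset _ (mulgI u)) -imset_comp.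
have -> // : u ^: A = [set (mulg u \o commg u) a | a in A].
by apply: eq_imset => a /=; rewrite conjg_mulR.
Qed.

(** * The NCCC-graph as a complete tripartite graph, and its part sizes *)

Variable t : gT.
Hypothesis GAt : t \in G :\: A.

Let M : {group gT} := (G^`(1) <*> 'Z(G))%G.

Let defM : M = G^`(1) * 'Z(G) :> {set gT}.
Proof. exact: norm_joinEr (subset_trans (center_sub G) (der_norm 1 G)). Qed.

Let sMA : M \subset A.
Proof. by rewrite join_subG sG'A. Qed.

Let sG'M : G^`(1) \subset M.
Proof. exact: joing_subl. Qed.

Let sZM : 'Z(G) \subset M.
Proof. exact: joing_subr. Qed.

Let card_index_M : #|M| = #|A| %/ 2 /\ #|A : M| = 2.
Proof.
have G'Z : (2 * #|M| = #|A|)%N.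
  by rewrite defM -card_der1_mul_center mul_cardG card_der1_center mulnC.
have M_gt0 := cardG_gt0 M.
split; first by rewrite -G'Z mulKn.
by rewrite -divgS // -G'Z mulnK.
Qed.

(* The parts of the graph: [None] for the classes inside [A], [Some true] and
   [Some false] for those inside [M t] and [(A \ M) t]. *)
Definition index2_colour (x : gT) : option bool :=
  if x \in A then None else Some (x * t^-1 \in M).

Let colourJ x g : x \in G -> g \in G -> index2_colour (x ^ g) = index2_colour x.
Proof.
move=> Gx Gg; rewrite /index2_colour memJ_norm ?(subsetP (normal_norm nsAG)) //.
have [//|Ax] := boolP (x \in A); congr Some.
have GAx : x \in G :\: A by rewrite inE Ax.
have : x ^ g \in G^`(1) :* x by rewrite -class_setDA // memJ_class.
by case/rcosetP=> b G'b ->; rewrite -mulgA (@groupMl _ M b _ (subsetP sG'M b G'b)).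
Qed.

(** An element of [A] commuting with one outside [A] is central. This excludes the mixed cases; when
    both lie outside [A], it makes [x * y^-1] central, hence a member of [M]. *)
Let colour_comm x y : x \in G -> x \notin 'Z(G) -> y \in G -> y \notin 'Z(G) ->
  x * y = y * x -> index2_colour x = index2_colour y.
Proof.
move=> Gx Zx Gy Zy xy; rewrite /index2_colour.
have [Ax|Ax] := boolP (x \in A); have [Ay|Ay] := boolP (y \in A) => //.
- by case/negP: Zx; apply: (@central_of_comm y); rewrite // inE Ay.
- by case/negP: Zy; apply: (@central_of_comm x); rewrite // inE Ax.
congr Some; have GAy : y \in G :\: A by rewrite inE Ay.
have [z Az Dx] := memG GAy Gx Ax; 
have Zz : z \in 'Z(G).
  apply: (@central_of_comm y z) => //.
  by apply: (mulIg y); rewrite -Dx xy Dx mulgA.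
by rewrite Dx -mulgA (@groupMl _ M z _ (subsetP sZM z Zz)).
Qed.

(** Outside [A], equal colours give [x = b * z * y] with [b] in [G'] and [z] central; then
    [b^-1 * x = z * y] is conjugate to [x] and commutes with [y]. *)
Let comm_colour x y : x \in G -> y \in G -> index2_colour x = index2_colour y ->
  exists2 g, g \in G & x ^ g * y = y * x ^ g.
Proof.
move=> Gx Gy; rewrite /index2_colour.
have [Ax|Ax] := boolP (x \in A); have [Ay|Ay] := boolP (y \in A) => //.
  by exists 1; rewrite ?group1 // conjg1 commA.
case=> Mxy; have Mxy' : x * y^-1 \in G^`(1) * 'Z(G).
  rewrite -defM; have [a Aa Dx] := memG GAt Gx Ax; have [b Ab Dy] := memG GAt Gy Ay.
  rewrite Dx Dy !mulgK in Mxy *; rewrite invMg mulgA mulgK.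
  (* If neither [a] nor [b] is in [M], both lie in the one nontrivial coset of [M] in [A]. *)
  have [Mb|nMb] := boolP (b \in M); first by rewrite groupM ?groupV // Mxy.
  have : a \in A :\: M by rewrite inE Mxy nMb.
  by rewrite (@index2_setD _ A M b) ?inE ?nMb ?card_index_M.2 // mem_rcoset.
have GAx : x \in G :\: A by rewrite inE Ax.
case/mulsgP: Mxy' => b z G'b Zz Dxy.
have : b^-1 * x \in x ^: G by rewrite class_setDA // mem_rcoset mulgK groupV.
case/imsetP=> g Gg Dg; exists g => //; rewrite -Dg.
have -> : b^-1 * x = z * y by apply: (mulgI b); rewrite mulKVg mulgA -Dxy mulgKV.
by have /centerP[_ cz] := Zz; rewrite mulgA -(cz y Gy).
Qed.

Let nZG : G \subset 'N('Z(G)).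
Proof. exact: normal_norm (center_normal G). Qed.

Let vertexP (C : {set gT}) :
  reflect (exists2 x, x \in G :\: 'Z(G) & C = x ^: G) (C \in nccc_vertices G).
Proof.
rewrite inE; apply: (iffP andP) => [[/imsetP[x Gx ->] Zx]|[x]].
  exists x => //; rewrite inE Gx andbT; apply: contra Zx => Zx.
  by rewrite class_sub_norm.
rewrite inE => /andP[Zx Gx] ->; rewrite mem_classes //; split=> //.
by apply: contra Zx => /subsetP; apply; apply: class_refl.
Qed.

Let colour_repr x : x \in G -> index2_colour (repr (x ^: G)) = index2_colour x.
Proof.
move=> Gx; have /imsetP[g Gg ->] : repr (x ^: G) \in x ^: G.
  exact: mem_repr (class_refl G x).
exact: colourJ.
Qed.

Let nccc_adj_colour x y : x \in G :\: 'Z(G) -> y \in G :\: 'Z(G) ->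
  nccc_adj G (x ^: G) (y ^: G) = (index2_colour x != index2_colour y).
Proof.
case/setDP=> Gx Zx /setDP[Gy Zy]; apply/andP/idP => [[_ adj]|neq_c].
  apply: contraL adj => /eqP/comm_colour[] // g Gg comm.
  apply/forall_inPn; exists (x ^ g); first exact: memJ_class.
  apply/forall_inPn; exists y; first exact: class_refl.
  by rewrite negbK comm.
split; first by apply: contra neq_c => /eqP xy; rewrite -(colour_repr Gx) xy (colour_repr Gy).
apply/forall_inP=> _ /imsetP[g Gg ->]; apply/forall_inP=> _ /imsetP[h Gh ->].
apply: contra neq_c => /eqP; rewrite -(colourJ Gx Gg) -(colourJ Gy Gh).
have ZJ z k : k \in G -> (z ^ k \in 'Z(G)) = (z \in 'Z(G)).
  by move=> Gk; rewrite memJ_norm // (subsetP nZG).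
by move=> xy; apply/eqP/colour_comm; rewrite ?ZJ //; apply: groupJ.
Qed.

(** Classes of one colour partition the noncentral elements of that colour, so uniform class size
    turns a count of elements into a count of vertices. *)
Let colour_count q n :
    {in G :\: 'Z(G), forall x, index2_colour x = q -> #|x ^: G| = n} ->
  (#|[set C in nccc_vertices G | index2_colour (repr C) == q]| * n)%N =
   #|[set x in G :\: 'Z(G) | index2_colour x == q]|.
Proof.
move=> card_n; set D := [set x in G :\: 'Z(G) | index2_colour x == q].
have nDG : [acts G, on D | 'J].
  rewrite astabsJ; apply/subsetP=> g Gg; rewrite inE; apply/subsetP=> _ /imsetP[x + ->].
  rewrite inE => /andP[/setDP[Gx Zx] /eqP cx].
  rewrite inE in_setD memJ_norm ?(subsetP nZG) // Zx groupJ //=.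
  by rewrite colourJ ?cx.
rewrite (@card_uniform_partition _ n _ _ _ (orbit_partition nDG)).
  congr (_ * _)%N; apply: eq_card => C; rewrite inE.
  apply/andP/imsetP=> [[/vertexP[x Gx ->] /eqP cx]|[x]].
    exists x => //; rewrite inE Gx -cx colour_repr ?eqxx //.
    by case/setDP: Gx.
  rewrite inE => /andP[Gx /eqP cx] ->; have [Gx' _] := setDP Gx.
  by split; [apply/vertexP; exists x | rewrite colour_repr ?cx].
move=> _ /imsetP[x + ->]; rewrite inE => /andP[Gx /eqP cx]; exact: card_n.
Qed.

(** The centraliser of a noncentral element of [A] is [A] itself, of index 2. *)
Let card_class_in a : a \in A -> a \notin 'Z(G) -> #|a ^: G| = 2.
Proof.
move=> Aa Za; rewrite -index_cent1 -iAG; congr #|G : _|.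
apply/setP=> g; apply/setIP/idP=> [[Gg /cent1P ag]|Ag].
  apply: contraR Za => Ag; apply: (@central_of_comm g) => //; by rewrite inE Ag.
by split; [apply: (subsetP sAG) | apply/cent1P; apply: commA].
Qed.

Let card_Some b : #|[set x in G :\: 'Z(G) | index2_colour x == Some b]| = #|M|.
Proof.
have [At Gt] : t \notin A /\ t \in G by move: GAt; rewrite inE => /andP[].
have -> : [set x in G :\: 'Z(G) | index2_colour x == Some b] =
          (if b then M : {set gT} else A :\: M) :* t.
  apply/setP=> x; rewrite mem_rcoset in_set in_setD /index2_colour.
  have [Ax|Ax] := boolP (x \in A).
    rewrite andbF; apply/esym/negP => tM; case/negP: At.
    have At' : x * t^-1 \in A.
      by case: b tM => [/(subsetP sMA)|/setDP[]].
    by rewrite -groupV -(groupMl _ Ax).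
  have -> /= : x \notin 'Z(G) by apply: contra Ax; apply: (subsetP sZA).
  have [Gx|Gx] := boolP (x \in G); last first.
    apply/esym/negP => tM; case/negP: Gx; rewrite -(groupMr _ (groupVr Gt)).
    by apply: (subsetP sAG); case: b tM => [/(subsetP sMA)|/setDP[]].
  have [a Aa ->] := memG GAt Gx Ax; rewrite mulgK.
  by case: b; rewrite ?inE ?Aa ?andbT; case: (a \in M).
rewrite card_rcoset; case: b => //.
rewrite cardsD (setIidPr sMA); have := Lagrange sMA; rewrite card_index_M.2 => <-.
by rewrite muln2 -addnn addnK.
Qed.

Let card_None : #|[set x in G :\: 'Z(G) | index2_colour x == None]| = (#|A| - #|'Z(G)|)%N.
Proof.
rewrite -{2}(setIidPr sZA) -cardsD; apply: eq_card => x; rewrite in_set !in_setD /index2_colour.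
have [Ax|//] := boolP (x \in A); last by rewrite !andbF.
by rewrite (subsetP sAG) // eqxx !andbT.
Qed.

Let colour_i (i : 'I_#|nccc_vertices G|) := index2_colour (repr (enum_val i)).

Let nccc_signless_laplacian_colour : nccc_signless_laplacian G = multipartite_Q colour_i.
Proof.
have adjE i C : C \in nccc_vertices G ->
    nccc_adj G (enum_val i) C = (colour_i i != index2_colour (repr C)).
  case/vertexP=> y GZy ->; rewrite /colour_i.
  have /vertexP[x GZx ->] := enum_valP i.
  by rewrite nccc_adj_colour // !colour_repr //; [case/setDP: GZy | case/setDP: GZx].
apply/matrixP=> i j; rewrite !mxE adjE ?enum_valP //; congr (_ * _%:R + _)%R.
rewrite (@card_enum_val _ _ (fun C => colour_i i != index2_colour (repr C))).
by apply: eq_card => C; rewrite !inE; apply: andb_id2l => VC; rewrite adjE // inE.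
Qed.

Lemma index2_Q_integral : nccc_Q_integral G <-> #|G^`(1)| = 2.
Proof.
have [p oZ] : exists p, #|'Z(G)| = (2 * p)%N.
  have /dvdnP[p ->] : 2 %| #|'Z(G)| by rewrite -card_der1_center cardSg ?subsetIr.
  by exists p; rewrite mulnC.
have Z_gt0 := cardG_gt0 ('Z(G))%G; have n_gt0 := cardG_gt0 (G^`(1))%G.
rewrite /= in Z_gt0 n_gt0.
have p_gt0 : 0 < p by move: Z_gt0; rewrite oZ; case: (p).
have oA : #|A| = (#|G^`(1)| * (2 * p))%N by rewrite -oZ card_der1_mul_center.
have oM : #|M| = (#|G^`(1)| * p)%N.
  by rewrite card_index_M.1 oA [(2 * p)%N]mulnC mulnA mulnK.
(* The order of [G'] is positive and even, hence at least 2; the part inside [A] then has size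
   [p * k.+1], so [k.+1] is the ratio that must equal 1. *)
have [k ok] : exists k, #|G^`(1)| = k.+2.
  by case: #|G^`(1)| n_gt0 evenG' => [|[|k]] // _ _; exists k.
have size_None : colour_class_size colour_i None = (p * k.+1)%N.
  rewrite /colour_class_size (@card_enum_val _ _ (fun C => index2_colour (repr C) == None)).
  apply/eqP; rewrite -(@eqn_pmul2r 2) // colour_count ?card_None ?oA ?oZ ?ok.
    by rewrite mulSn addKn mulnCA [eqbRHS]mulnC [(k.+1 * p)%N]mulnC.
  move=> x /setDP[Gx Zx]; rewrite /index2_colour; case: ifP => // Ax _.
  exact: card_class_in.
have size_Some q : q != None -> colour_class_size colour_i q = p.
  case: q => // b _.
  rewrite /colour_class_size (@card_enum_val _ _ (fun C => index2_colour (repr C) == Some b)).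
  apply/eqP; rewrite -(eqn_pmul2r n_gt0) colour_count.
    by rewrite card_Some oM mulnC.
  move=> x /setDP[Gx Zx]; rewrite /index2_colour; case: ifP => // /negbT Ax _.
  by rewrite class_setDA ?card_rcoset // inE Ax.
have card3 : #|{: option bool}| = 3 by rewrite card_option card_bool.
rewrite /nccc_Q_integral nccc_signless_laplacian_colour ok.
split=> [intQ|[k0] a].
  by rewrite (multipartite_Q_integral_k_eq1 card3 p_gt0 _ size_None size_Some intQ).
by apply: (multipartite_Q_integral1 card3 size_None size_Some); rewrite // k0.
Qed.

End AbelianIndex2.

(** * Reduction for groups generated by two elements *)

Section TwoGenerators.
Variables (gT : finGroupType) (G : {group gT}) (a t : gT).
Hypotheses (genG : G :=: <[a]> <*> <[t]>) (a_t2 : commute a (t ^+ 2)).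
Hypothesis A_at : a ^ t \in <[a]> <*> <[t ^+ 2]>.

Let A : {group gT} := (<[a]> <*> <[t ^+ 2]>)%G.

Let Aa : a \in A.
Proof. by rewrite -cycle_subG joing_subl. Qed.

Let At2 : t ^+ 2 \in A.
Proof. by rewrite -cycle_subG joing_subr. Qed.

Let abelA : abelian A.
Proof.
rewrite abelianY !cycle_abelian /= cycle_subG; apply/centP=> x /cycleP[i ->].
exact/commuteX/commute_sym.
Qed.

Let Ga : a \in G. Proof. by rewrite genG -cycle_subG joing_subl. Qed.
Let Gt : t \in G. Proof. by rewrite genG -cycle_subG joing_subr. Qed.

Let sAG : A \subset G.
Proof. by rewrite join_subG !cycle_subG Ga groupX. Qed.

Let Aw : [~ a, t] \in A.
Proof. by rewrite commgEl groupM ?groupV. Qed.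

(** Conjugation by [t] exchanges [a] and [a ^ t], since [t ^+ 2] commutes with [a]. *)
Let comm_conj : [~ a, t] ^ t = [~ a, t]^-1.
Proof.
rewrite commgEl conjMg -conjgM -(expgS t 1) conjVg.
by have /commgP/conjg_fixP-> := a_t2; rewrite [RHS]invMg invgK.
Qed.

(** The cycle of the commutator is normal, as [a] centralises it and [t] inverts it, and modulo it
    the two generators commute. *)
Lemma two_gen_der1 : G^`(1) = <[ [~ a, t] ]>.
Proof.
apply/eqP; rewrite eqEsubset cycle_subG mem_commg // andbT.
have -> : G = <<[set a; t]>>%G.
  by apply: val_inj; rewrite /= genG joing_idl joing_idr.
apply: der1_gen_sub.
  apply/subsetP=> g /set2P[] ->; rewrite inE -cycleJ cycle_subG.
    rewrite (_ : _ ^ a = [~ a, t]) ?cycle_id //; apply/conjg_fixP/commgP.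
    exact: (centsP abelA).
  by rewrite comm_conj groupV cycle_id.
move=> x y /set2P[] -> /set2P[] ->; rewrite ?commgg ?group1 ?cycle_id //.
by rewrite -invgR groupV cycle_id.
Qed.

Lemma two_gen_Q_integral :
  ~~ odd #[ [~ a, t] ] -> (nccc_Q_integral G <-> #[ [~ a, t] ] = 2).
Proof.
move=> even_w; rewrite orderE -two_gen_der1.
have evenG' : ~~ odd #|G^`(1)| by rewrite two_gen_der1.
have nAt : t \in 'N(A).
  rewrite inE /A /= -genJ gen_subG conjUg -!cycleJ subUset !cycle_subG A_at /=.
  by rewrite conjXg conjgE mulKg.
(* Otherwise [G = A] would be abelian and [G'] of odd order 1. *)
have GAt : t \in G :\: A.
  rewrite inE Gt andbT; apply: contra evenG' => At.
  have sGA : G \subset A by rewrite genG join_subG !cycle_subG Aa At.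
  by rewrite (derG1P (abelianS sGA abelA)) cards1.
apply: (@index2_Q_integral _ G A sAG abelA _ _ evenG' t GAt); last first.
  by rewrite two_gen_der1 cycle_cyclic.
have nAG : G \subset 'N(A).
  by rewrite genG join_subG !cycle_subG nAt (subsetP (normG A)).
(* The quotient by [A] is generated by the image of [t], which is nontrivial and has trivial
   square. *)
rewrite -card_quotient //.
have -> : G :=: A <*> <[t]>.
  apply/eqP; rewrite eqEsubset {1}genG !join_subG !cycle_subG Ga Gt groupX // !andbT.
  by rewrite (subsetP (joing_subl A _)) // (subsetP (joing_subr A _)) ?cycle_id.
rewrite quotientYidl ?cycle_subG // quotient_cycle //.
rewrite -orderE; apply: nt_prime_order => //.
  by rewrite -morphX //=; apply: coset_id.
apply: contraTneq GAt => /coset_idr At; by rewrite inE At.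
Qed.
End TwoGenerators.

(** * Permutation models and lower bounds on commutator orders *)

Lemma order_comm_inverted (gT : finGroupType) (x y : gT) (q : nat) :
  #[x] = (2 * q)%N -> x ^ y = x^-1 -> #[ [~ x, y] ] = q.
Proof.
move=> ox xy; rewrite commgEl xy -invMg -(expgS x 1) orderV.
by rewrite orderXdiv ox ?dvdn_mulr // mulKn.
Qed.

(** A commutator computed in a homomorphic image bounds [G'] from below, since [G'] maps onto the
    derived subgroup of the image. *)
Lemma dvdn_order_comm_homg (gT rT : finGroupType) (G : {group gT}) (H : {group rT}) u v :
  H \homg G -> u \in H -> v \in H -> #[ [~ u, v] ] %| #|G^`(1)|.
Proof.
case/homgP=> f fG Hu Hv.
have : #|H^`(1)| %| #|G^`(1)|.
  by rewrite -fG -morphim_der // dvdn_morphim.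
by apply: dvdn_trans; apply: order_dvdG; apply: mem_commg.
Qed.

Section MetacyclicModel.
Variables N r k : nat.
Hypotheses (N_gt1 : 1 < N) (rr1 : r * r = 1 %[mod N]) (rkk : r * k = k %[mod N]).

(* On <X, Y> with X ^ N = 1, Y ^ 2 = X ^ k, X ^ Y = X ^ r, the pair (b, e)
   stands for X ^ b Y ^ e, and [rotate], [swap] are right multiplication by X, Y. *)
Let rotate (u : 'Z_N * bool) : 'Z_N * bool :=
  ((u.1 + (if u.2 then r%:R else 1))%R, u.2).
Let swap (u : 'Z_N * bool) : 'Z_N * bool :=
  ((u.1 + (if u.2 then k%:R else 0))%R, ~~ u.2).

Let rotate_inj : injective rotate.
Proof.
move=> [b e] [b' e'] /eqP; rewrite xpair_eqE /= => /andP[/eqP + /eqP ee].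
by rewrite ee => /addIr->.
Qed.

Let swap_inj : injective swap.
Proof.
move=> [b e] [b' e'] /eqP; rewrite xpair_eqE /= => /andP[/eqP + /eqP/negb_inj ee].
by rewrite ee => /addIr->.
Qed.

(** The congruences are the consistency conditions: [Y ^+ 2], a power of [X], must centralise [X],
    and [Y] must centralise [Y ^+ 2 = X ^+ k]. *)
Lemma metacyclic_perms : exists X Y : {perm 'Z_N * bool},
  [/\ #[X] = N, Y ^+ 2 = X ^+ k & X ^ Y = X ^+ r].
Proof.
have modZ i j : i = j %[mod N] -> (i%:R = j%:R :> 'Z_N)%R.
  by move=> ij; apply: val_inj; rewrite /= !val_Zp_nat.
exists (perm rotate_inj), (perm swap_inj); set X := perm _; set Y := perm _.
have XE i b e : (X ^+ i) (b, e) = ((b + (if e then r%:R else 1) *+ i)%R, e).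
  rewrite permX; elim: i => [|i /= ->]; first by rewrite addr0.
  by rewrite permE /rotate /= mulrSr addrA.
have X1E b e : X (b, e) = ((b + (if e then r%:R else 1))%R, e) by rewrite permE.
have YE b e : Y (b, e) = ((b + (if e then k%:R else 0))%R, ~~ e) by rewrite permE.
split.
- apply/eqP; rewrite eqn_dvd order_dvdn; apply/andP; split.
    apply/eqP/permP=> -[b e]; rewrite XE perm1; congr (_, _).
    by rewrite -mulr_natr pchar_Zp // mulr0 addr0.
  (* The pair [(0, false)] stands for the identity; its orbit under [X] already has length [N]. *)
  have /permP/(_ (0%R, false)) := expg_order X.
  rewrite XE perm1 add0r => -[/(congr1 val)] /=.
  by rewrite val_Zp_nat // => /eqP.
- apply/permP=> -[b e]; rewrite expgS expg1 permM !YE XE negbK; congr (_, _).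
  case: e => /=; first by rewrite addr0 -mulrnA (modZ _ _ rkk).
  by rewrite addr0.
(* The relation is checked as [X * Y = Y * X ^+ r]; on pairs with second entry [false] it amounts to
   [rr1]. *)
apply: (mulgI Y); rewrite -conjgC; apply/permP=> -[b e]; rewrite !permM X1E !YE XE.
congr (_, _); case: e => /=; first by rewrite addrAC.
by rewrite !addr0 -mulrnA (modZ _ _ rr1).
Qed.
End MetacyclicModel.

(** The dihedral group of order [4 * q]: the metacyclic model with modulus [2 * q], [r = -1] and
    [k = 0], where the commutator is [X^-1 ^+ 2]. *)
Lemma dihedral_model q : 0 < q -> exists (rT : finGroupType) (X Y : rT),
  [/\ X ^+ (2 * q) = 1, Y ^+ 2 = 1, X ^ Y = X^-1 & #[ [~ X, Y] ] = q].
Proof.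
case: q => // q _; have [|||X [Y [oX Y2 XY]]] := @metacyclic_perms (2 * q.+1) (2 * q).+1 0.
- by rewrite mulnS.
- rewrite (_ : (_ * _)%N = 2 * q * (2 * q.+1) + 1)%N ?modnMDl //; ring.
- by rewrite muln0.
have XYV : X ^ Y = X^-1.
  rewrite XY; apply/eqP; rewrite eq_sym eq_invg_mul -expgS.
  by rewrite -order_dvdn oX mulnS.
exists _, X, Y; split=> //; first by rewrite -[X in _ ^+ X]oX expg_order.
exact: order_comm_inverted oX XYV.
Qed.

(** * The five families of presentations *)

Lemma invg_sqr1 (gT : finGroupType) (x : gT) : x ^+ 2 = 1 -> x^-1 = x.
Proof. by move=> x2; apply/eqP; rewrite eq_invg_mul -(expgS x 1) x2. Qed.

Lemma order_two (gT : finGroupType) (w : gT) : w ^+ 2 = 1 -> ~~ odd #[w] -> #[w] = 2.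
Proof.
move=> /eqP; rewrite -order_dvdn => /(dvdn_leq (isT : 0 < 2)).
by case: #[w] (order_gt0 w) => [|[|[|]]].
Qed.

Lemma comm_inverted_sqr (gT : finGroupType) (x y : gT) :
  x ^+ 4 = 1 -> x ^ y = x^-1 -> [~ x, y] ^+ 2 = 1.
Proof.
by move=> x4 xy; rewrite commgEl xy -(expgS x^-1 1) -expgM expgVn x4 invg1.
Qed.

Lemma dvdn_even d n : d %| n -> ~~ odd d -> ~~ odd n.
Proof. by rewrite -!dvdn2 => dn d2; apply: dvdn_trans dn. Qed.

(** With [m = 2 * q], the model shows that the even number [q] divides the order of [[~ x, y]].
    Order 2 therefore leaves only [q = 2]; conversely [x ^+ 4 = 1] makes the commutator square to
    1. *)
Lemma dihedral_Q_integral (gT : finGroupType) (G : {group gT}) (m : nat) :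
    3 < m -> ~~ odd m -> ~~ odd (m %/ 2) ->
    G \isog Grp (x : y : (x ^+ m, y ^+ 2, y * x * y^-1 = x^-1)) ->
  nccc_Q_integral G <-> m = 4.
Proof.
move=> m_gt3 even_m; have [q Dm] : exists q, m = (2 * q)%N.
  by exists m./2; rewrite mul2n even_halfK.
rewrite Dm mulKn // => even_q isoG.
have /existsP[[x y] /eqP[genG xm y2 yx]] := isoGrp_hom isoG.
have Dyv : y^-1 = y by apply: invg_sqr1.
have xy : x ^ y = x^-1 by rewrite conjgE Dyv -yx Dyv mulgA.
have q_gt0 : 0 < q by move: m_gt3; rewrite Dm; case: (q).
have [rT [X [Y [Xq Y2 XY oXY]]]] := dihedral_model q_gt0.
have Dx_y2 : commute x (y ^+ 2) by rewrite y2; apply: commute1.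
have A_xy : x ^ y \in <[x]> <*> <[y ^+ 2]>.
  by rewrite xy groupV -cycle_subG joing_subl.
have q_dvd : q %| #[ [~ x, y] ].
  rewrite orderE -(two_gen_der1 (esym genG) Dx_y2 A_xy) -oXY.
  apply: (@dvdn_order_comm_homg _ _ _ (<[X]> <*> <[Y]>)%G); last 2 first.
  - by rewrite -cycle_subG joing_subl.
  - by rewrite -cycle_subG joing_subr.
  rewrite isoG; apply/existsP; exists (X, Y); rewrite /= !xpair_eqE !eqxx /=.
  by rewrite Xq Y2 -XY conjgE (invg_sqr1 Y2) mulgA !eqxx.
have even_w := dvdn_even q_dvd even_q.
rewrite (two_gen_Q_integral (esym genG) Dx_y2 A_xy even_w); split=> [w2|q4].
  by move: q_dvd m_gt3; rewrite w2 Dm => /(dvdn_leq (isT : 0 < 2)); lia.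
by apply: order_two => //; apply: comm_inverted_sqr => //; rewrite -q4.
Qed.

(** The dihedral argument with the generators exchanged: [y] goes to the rotation and [x] to the
    reflection, whose even power [2 * n] is trivial. *)
Lemma U_Q_integral (gT : finGroupType) (G : {group gT}) (n m : nat) :
    3 < m -> ~~ odd m -> ~~ odd (m %/ 2) ->
    G \isog Grp (x : y : (x ^+ (2 * n), y ^+ m, x^-1 * y * x = y^-1)) ->
  nccc_Q_integral G <-> m = 4.
Proof.
move=> m_gt3 even_m; have [q Dm] : exists q, m = (2 * q)%N.
  by exists m./2; rewrite mul2n even_halfK.
rewrite Dm mulKn // => even_q isoG.
have /existsP[[x y] /eqP[genG xn ym xyx]] := isoGrp_hom isoG.
have yx : y ^ x = y^-1 by rewrite conjgE mulgA.
have q_gt0 : 0 < q by move: m_gt3; rewrite Dm; case: (q).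
have [rT [X [Y [Xq Y2 XY oXY]]]] := dihedral_model q_gt0.
have Dy_x2 : commute y (x ^+ 2).
  by apply/commgP/conjg_fixP; rewrite (expgS x 1) conjgM yx conjVg yx invgK.
have A_yx : y ^ x \in <[y]> <*> <[x ^+ 2]>.
  by rewrite yx groupV -cycle_subG joing_subl.
have genG' : G :=: <[y]> <*> <[x]> by rewrite joingC.
have q_dvd : q %| #[ [~ y, x] ].
  rewrite orderE -(two_gen_der1 genG' Dy_x2 A_yx) -oXY.
  apply: (@dvdn_order_comm_homg _ _ _ (<[Y]> <*> <[X]>)%G); last 2 first.
  - by rewrite -cycle_subG joing_subr.
  - by rewrite -cycle_subG joing_subl.
  rewrite isoG; apply/existsP; exists (Y, X); rewrite /= !xpair_eqE !eqxx /=.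
  by rewrite Xq expgM Y2 expg1n -XY conjgE mulgA !eqxx.
have even_w := dvdn_even q_dvd even_q.
rewrite (two_gen_Q_integral genG' Dy_x2 A_yx even_w); split=> [w2|q4].
  by move: q_dvd m_gt3; rewrite w2 Dm => /(dvdn_leq (isT : 0 < 2)); lia.
by apply: order_two => //; apply: comm_inverted_sqr => //; rewrite -q4.
Qed.

Lemma dicyclic_Q_integral (gT : finGroupType) (G : {group gT}) (m : nat) :
    1 < m -> ~~ odd m ->
    G \isog Grp (x : y : (x ^+ (2 * m), x ^+ m = y ^+ 2, y^-1 * x * y = x^-1)) ->
  nccc_Q_integral G <-> m = 2.
Proof.
move=> m_gt1 even_m isoG.
have /existsP[[x y] /eqP[genG x2m xm yxy]] := isoGrp_hom isoG.
have xy : x ^ y = x^-1 by rewrite conjgE mulgA.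
have Dx_y2 : commute x (y ^+ 2) by rewrite -xm; apply: commuteX.
have A_xy : x ^ y \in <[x]> <*> <[y ^+ 2]>.
  by rewrite xy groupV -cycle_subG joing_subl.
have m_dvd : m %| #[ [~ x, y] ].
  (* Here [r = -1] modulo [2 * m], and [k = m] is compatible because [-m] and [m] agree modulo
     [2 * m]. *)
  have [|||X [Y [oX Y2 XY]]] := @metacyclic_perms (2 * m) (2 * m).-1 m.
  - by case: (m) m_gt1 => [|[|]].
  - case: (m) m_gt1 => // q _.
    rewrite (_ : (2 * q.+1).-1 = (2 * q).+1); last by rewrite mulnS.
    rewrite (_ : (_ * _)%N = 2 * q * (2 * q.+1) + 1)%N ?modnMDl //; ring.
  - case: (m) m_gt1 => // q _.
    rewrite (_ : (2 * q.+1).-1 = (2 * q).+1); last by rewrite mulnS.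
    rewrite (_ : (_ * _)%N = q * (2 * q.+1) + q.+1)%N ?modnMDl //; ring.
  have XYV : X ^ Y = X^-1.
    rewrite XY; apply/eqP; rewrite eq_sym eq_invg_mul -expgS.
    by rewrite -order_dvdn oX prednK ?dvdnn // muln_gt0 (ltnW m_gt1).
  rewrite orderE -(two_gen_der1 (esym genG) Dx_y2 A_xy) -(order_comm_inverted oX XYV).
  apply: (@dvdn_order_comm_homg _ _ _ (<[X]> <*> <[Y]>)%G); last 2 first.
  - by rewrite -cycle_subG joing_subl.
  - by rewrite -cycle_subG joing_subr.
  rewrite isoG; apply/existsP; exists (X, Y); rewrite /= !xpair_eqE !eqxx /=.
  by rewrite -order_dvdn oX dvdnn Y2 -XYV conjgE mulgA !eqxx.
have even_w := dvdn_even m_dvd even_m.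
rewrite (two_gen_Q_integral (esym genG) Dx_y2 A_xy even_w); split=> [w2|m2].
  by apply/eqP; rewrite eqn_leq m_gt1 dvdn_leq // -w2.
by apply: order_two => //; apply: comm_inverted_sqr => //; rewrite -x2m m2.
Qed.

(** The commutator is [x^-1 ^+ 2 * y ^+ 2]. A dihedral quotient killing [y ^+ 2] shows that [m]
    divides its order; as [m] may be odd, evenness comes from a second quotient. *)
Lemma V_Q_integral (gT : finGroupType) (G : {group gT}) (m : nat) :
    1 < m ->
    G \isog Grp (x : y : (x ^+ (2 * m), y ^+ 4, y * x = x^-1 * y^-1,
                          y^-1 * x = x^-1 * y)) ->
  nccc_Q_integral G <-> m = 2.
Proof.
move=> m_gt1 isoG.
have /existsP[[x y] /eqP[genG xm y4 yx yVx]] := isoGrp_hom isoG.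
have xy : x ^ y = x^-1 * y ^+ 2 by rewrite conjgE mulgA yVx -mulgA.
have y2V : (y ^+ 2)^-1 = y ^+ 2 by apply: invg_sqr1; rewrite -expgM y4.
(* Both products equal [x ^ y]: one by the second relation, the other because [y ^+ 2] is its own
   inverse and [x^-1 = y * x * y] by the first. *)
have xV_y2 : commute x^-1 (y ^+ 2).
  have yxy : y * x * y = x^-1 by rewrite yx mulgKV.
  by rewrite /commute -xy -[in RHS]y2V -[in RHS]yxy expgS expg1 invMg conjgE -!mulgA mulKg.
have Dx_y2 : commute x (y ^+ 2) by rewrite -(invgK x); apply/commute_sym/commuteV/commute_sym.
have A_xy : x ^ y \in <[x]> <*> <[y ^+ 2]>.
  by rewrite xy groupM ?groupV // -cycle_subG ?joing_subl ?joing_subr.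
have m_dvd : m %| #[ [~ x, y] ].
  have [rT [X [Y [Xm Y2 XY oXY]]]] := dihedral_model (ltnW m_gt1).
  rewrite orderE -(two_gen_der1 (esym genG) Dx_y2 A_xy) -oXY.
  apply: (@dvdn_order_comm_homg _ _ _ (<[X]> <*> <[Y]>)%G); last 2 first.
  - by rewrite -cycle_subG joing_subl.
  - by rewrite -cycle_subG joing_subr.
  rewrite isoG; apply/existsP; exists (X, Y); rewrite /= !xpair_eqE !eqxx /=.
  have YX : Y * X = X^-1 * Y by rewrite -XY conjgE (invg_sqr1 Y2) -!mulgA -(expgS Y 1) Y2 mulg1.
  by rewrite Xm (expgM Y 2 2) Y2 expg1n (invg_sqr1 Y2) YX !eqxx.
have even_w : ~~ odd #[ [~ x, y] ].
  (* The dihedral group of order 8 is a quotient of V_(8m) with y mapped to the rotation. *)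
  have [rT [X [Y [X4 Y2 XY oXY]]]] := @dihedral_model 2 isT.
  apply: (@dvdn_even 2) => //; rewrite orderE -(two_gen_der1 (esym genG) Dx_y2 A_xy) -oXY.
  apply: (@dvdn_order_comm_homg _ _ _ (<[Y]> <*> <[X]>)%G); last 2 first.
  - by rewrite -cycle_subG joing_subr.
  - by rewrite -cycle_subG joing_subl.
  rewrite isoG; apply/existsP; exists (Y, X); rewrite /= !xpair_eqE !eqxx /=.
  have YX : X * Y = Y * X^-1 by rewrite conjgC XY.
  have XVY : X^-1 * Y = Y * X by rewrite conjgC conjVg XY invgK.
  by rewrite expgM Y2 expg1n X4 (invg_sqr1 Y2) YX XVY !eqxx.
rewrite (two_gen_Q_integral (esym genG) Dx_y2 A_xy even_w); split=> [w2|m2].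
  by apply/eqP; rewrite eqn_leq m_gt1 dvdn_leq // -w2.
apply: order_two => //; rewrite commgEl xy mulgA -(expgS x^-1 1) expgMn; last first.
  exact/commute_sym/commuteX/commute_sym.
by rewrite -!expgM y4 expgVn [x ^+ _](_ : _ = 1) ?invg1 ?mulg1 // -xm m2.
Qed.

(** The model with modulus [4 * m], [r = 2 * m - 1] and [k = 0] has commutator [X ^+ (2 * j)], where
    [j = m - 1] is odd. This forces the order of [[~ x, y]] to be even but different from 2. *)
Lemma semidihedral_not_Q_integral (gT : finGroupType) (G : {group gT}) (m : nat) :
    1 < m -> ~~ odd m ->
    G \isog Grp (x : y : (x ^+ (4 * m), y ^+ 2, y * x * y = x ^+ (2 * m - 1))) ->
  ~ nccc_Q_integral G.
Proof.
move=> m_gt1 even_m isoG.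
have /existsP[[x y] /eqP[genG xm y2 yxy]] := isoGrp_hom isoG.
have xy : x ^ y = x ^+ (2 * m - 1) by rewrite conjgE (invg_sqr1 y2) mulgA.
have Dx_y2 : commute x (y ^+ 2) by rewrite y2; apply: commute1.
have A_xy : x ^ y \in <[x]> <*> <[y ^+ 2]>.
  by rewrite xy groupX // -cycle_subG joing_subl.
have [j Dm] : exists j, m = j.+1 by exists m.-1; rewrite prednK // ltnW.
have D2m1 : (2 * m - 1 = (2 * j).+1)%N by rewrite Dm; lia.
have [|||X [Y [oX Y2 XY]]] := @metacyclic_perms (4 * m) (2 * m - 1) 0.
- by rewrite Dm mulnS.
- rewrite D2m1 Dm (_ : (_ * _)%N = j * (4 * j.+1) + 1)%N ?modnMDl //; ring.
- by rewrite muln0.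
have comXY : [~ X, Y] = X ^+ (2 * j).
  by rewrite commgEl XY D2m1 expgS mulKg.
have oXY : #[ [~ X, Y] ] %| #[ [~ x, y] ].
  rewrite [X in _ %| X]orderE -(two_gen_der1 (esym genG) Dx_y2 A_xy).
  apply: (@dvdn_order_comm_homg _ _ _ (<[X]> <*> <[Y]>)%G); last 2 first.
  - by rewrite -cycle_subG joing_subl.
  - by rewrite -cycle_subG joing_subr.
  rewrite isoG; apply/existsP; exists (X, Y); rewrite /= !xpair_eqE !eqxx /=.
  by rewrite -order_dvdn oX dvdnn Y2 -XY conjgE (invg_sqr1 Y2) mulgA !eqxx.
(* [X ^+ (2 * j * i) = 1] means that [4 * m] divides [2 * j * i]. Taking for [i] the order of
   [[~ x, y]] gives its evenness, as [j] is odd. *)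
have dvd_oXY i : #[ [~ X, Y] ] %| i -> 2 * m %| j * i.
  rewrite comXY order_dvdn -expgM -order_dvdn oX (_ : 4 * m = 2 * (2 * m))%N; last by rewrite mulnA.
  by rewrite -mulnA dvdn_pmul2l.
have odd_j : odd j by move: even_m; rewrite Dm /= negbK.
have even_w : ~~ odd #[ [~ x, y] ].
  have := dvdn_trans (dvdn_mulr m (dvdnn 2)) (dvd_oXY _ oXY).
  by rewrite dvdn2 oddM odd_j.
rewrite (two_gen_Q_integral (esym genG) Dx_y2 A_xy even_w) => w2.
(* For order 2, [m = j.+1] would divide [j], which is positive because odd. *)
move: oXY; rewrite w2 => /dvd_oXY; rewrite [(j * 2)%N]mulnC dvdn_pmul2l // Dm.
by move/(dvdn_leq (odd_gt0 odd_j)); rewrite ltnn.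
Qed.

Theorem theorem3p4 :
  (* (a) dihedral D_{2m} *)
  (forall (gT : finGroupType) (G : {group gT}) (m : nat),
     (4 <= m)%N -> ~~ odd m -> ~~ odd (m %/ 2) ->
     G \isog Grp (x : y : (x ^+ m, y ^+ 2, y * x * y^-1 = x^-1)) ->
     (nccc_Q_integral G <-> m = 4%N)) /\
  (* (a) U_{(n,m)}, n >= 2 *)
  (forall (gT : finGroupType) (G : {group gT}) (n m : nat),
     (2 <= n)%N -> (4 <= m)%N -> ~~ odd m -> ~~ odd (m %/ 2) ->
     G \isog Grp (x : y : (x ^+ (2 * n), y ^+ m, x^-1 * y * x = y^-1)) ->
     (nccc_Q_integral G <-> m = 4%N)) /\
  (* (b) dicyclic T_{4m} *)
  (forall (gT : finGroupType) (G : {group gT}) (m : nat),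
     (2 <= m)%N -> ~~ odd m ->
     G \isog Grp (x : y : (x ^+ (2 * m), x ^+ m = y ^+ 2, y^-1 * x * y = x^-1)) ->
     (nccc_Q_integral G <-> m = 2%N)) /\
  (* (c) V_{8m} *)
  (forall (gT : finGroupType) (G : {group gT}) (m : nat),
     (2 <= m)%N ->
     G \isog Grp (x : y : (x ^+ (2 * m), y ^+ 4, y * x = x^-1 * y^-1,
                           y^-1 * x = x^-1 * y)) ->
     (nccc_Q_integral G <-> m = 2%N)) /\
  (* (d) semidihedral SD_{8m} *)
  (forall (gT : finGroupType) (G : {group gT}) (m : nat),
     (2 <= m)%N -> ~~ odd m ->
     G \isog Grp (x : y : (x ^+ (4 * m), y ^+ 2, y * x * y = x ^+ (2 * m - 1))) ->
     ~ nccc_Q_integral G).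
Proof.
split; first exact: dihedral_Q_integral.
split; first by move=> gT G n m _; apply: U_Q_integral.
split; first exact: dicyclic_Q_integral.
split; first exact: V_Q_integral.
exact: semidihedral_not_Q_integral.
Qed.
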